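(* Let $d\ge 2$ be an integer. Then $$\rho_d(N)=\sum_{k=1}^{d-1}\pi\left(\frac{N}{k}\right)+O_d\left(\pi(N^{1/2})\right),$$ where $\pi(x)$ denotes the number of primes not exceeding $x$ and the implied constant depends only on $d$.
   Context: For positive integers $d$ and $N$, $\rho_d(N)$ denotes the maximum size of a set $A\subseteq\{1,2,\dots,N\}$ such that there are no $\ell\ge 1$, pairwise distinct $a_1,\dots,a_\ell\in A$ and integer $x$ with $a_1a_2\cdots a_\ell=x^d$ (i.e., no product of distinct elements of $A$ is a perfect $d$-th power). *)

(* Defs.v *)
From mathcomp Require Import all_boot all_order all_algebra.
From mathcomp Require Import boolp reals.

Set Implicit Arguments.
Unset Strict Implicit.
Unset Printing Implicit Defensive.

Import Order.TTheory GRing.Theory Num.Theory.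

Local Open Scope ring_scope.

Definition primepi (R : realType) (x : R) : nat :=
  count prime (iota 0 (Num.truncn x).+1).

(* [A] is read as a set of positive integers bounded by [N]; a choice of
   pairwise distinct a_1, ..., a_l in A with l >= 1 is a nonempty B \subset A. *)
Definition power_product_free (d N : nat) (A : {set 'I_N.+1}) : Prop :=
  forall B : {set 'I_N.+1}, B \subset A -> B != set0 ->
    ~ exists x : int, (\prod_(a in B) (a : nat))%N%:Z = x ^+ d.

(* The maximum is over a nonempty family: A = set0 qualifies. *)
Definition rho (d N : nat) : nat :=
  \max_(A : {set 'I_N.+1} |
        (A \subset [set a : 'I_N.+1 | (0 < a)%N]) &&
        `[< power_product_free d A >]) #|A|.

(* Main.v *)
(* Lower bound: the integers p k with p > sqrt N prime and k < d contain no
   power product, since such a p divides between 1 and d - 1 factors, each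
   exactly once.

   Upper bound: call "block" a nonempty subset of A of at most d elements whose
   product has, at every prime q > sqrt N, a valuation divisible by d.  Blocks
   of a maximal disjoint family amount to vectors of (Z/d)^r, with
   r = pi (sqrt N), having no zero-sum subfamily, so there are O_d(r) of them.
   The elements of A left over contain no block: each is divisible by a prime
   q > sqrt N, and each such q divides at most min (d - 1, N / q) of them.

   The zero-sum bound, linear in r for every d, is the argument of van Emde Boas
   and Kruyswijk: with w a primitive d-th root of unity, once there are enough
   vectors v_j some exponents a_j make prod_j (w ^ a_j - chi (v_j)) vanish at
   every character chi of (Z/d)^r, and summing the expansion over chi leaves
   only the zero-sum subfamilies, the empty one not vanishing. *)
Require Import Defs.
From mathcomp Require Import all_boot all_order all_algebra all_field.
From mathcomp Require Import boolp reals.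
From mathcomp Require Import zify.

Set Implicit Arguments.
Unset Strict Implicit.
Unset Printing Implicit Defensive.

Import Order.TTheory GRing.Theory Num.Theory.

Local Open Scope ring_scope.

(** * Zero-sum subfamilies modulo d *)

Lemma mul_exp_pred_lt (d : nat) : (1 < d)%N -> (d * d.-1 ^ (d * d) < d ^ (d * d))%N.
Proof.
case: d => [|[|m]] //= _; set K := (m.+2 * m.+2)%N.
(* Bernoulli's inequality for (1 + 1 / m.+1) ^ n, with denominators cleared. *)
have bernoulli n : (m.+1 ^ n * (m.+1 + n) <= m.+1 * m.+2 ^ n)%N.
  elim: n => [|n IHn]; first by rewrite !expn0 mul1n addn0 muln1.
  rewrite [(m.+2 ^ _)%N]expnSr mulnA (leq_trans _ (leq_mul IHn (leqnn m.+2))) //.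
  by rewrite expnSr -!mulnA leq_mul2l; apply/orP; right; nia.
rewrite -(@ltn_pmul2l m.+1) //; apply: leq_trans (bernoulli K).
by rewrite mulnA mulnC ltn_pmul2l ?expn_gt0 // /K; nia.
Qed.

Lemma sum_powers_root_unity (d V : nat) (w : algC) : d.-primitive_root w ->
  \sum_(k < d) w ^+ (k * V) = (if d %| V then d else 0)%N%:R.
Proof.
move=> wP; under eq_bigr do rewrite mulnC exprM.
rewrite (prim_order_dvd wP); case: eqVneq => [->|wV1].
  by under eq_bigr do rewrite expr1n; rewrite sumr_const card_ord.
apply: (mulfI (x := w ^+ V - 1)); first by rewrite subr_eq0.
by rewrite -subrX1 -exprM mulnC exprM (prim_expr_order wP) expr1n subrr mulr0.
Qed.

Lemma card_ffun_avoid (d : nat) (J : finType) (c : J -> 'I_d) :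
  #|[set a : {ffun J -> 'I_d} | [forall j, a j != c j]]| = (d.-1 ^ #|J|)%N.
Proof.
rewrite (@eq_card _ _ (family (fun j => predC1 (c j)))); last first.
  by move=> a; rewrite !inE; apply/forallP/familyP=> aP j; have := aP j.
rewrite card_family foldrE big_map big_enum /=.
under eq_bigr do rewrite cardC1 card_ord.
by rewrite prod_nat_const.
Qed.

(* Averaging over [a]: each [t] is missed by exactly [d.-1 ^ #|J|] functions. *)
Lemma exists_ffun_hitting (d : nat) (J T : finType) (c : T -> J -> 'I_d) :
  (d.-1 ^ #|J| * #|T| < d ^ #|J|)%N ->
  exists a : {ffun J -> 'I_d}, forall t, exists j, a j = c t j.
Proof.
move=> lt_card; pose miss (a : {ffun J -> 'I_d}) t := [forall j, a j != c t j].
have [a aP|all_miss] := pickP [pred a | [forall t, ~~ miss a t]].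
  exists a => t; have /forallP/(_ t)/forallPn[j] := aP.
  by rewrite negbK => /eqP; exists j.
move: lt_card; rewrite ltnNge => /negP[].
have -> : (d ^ #|J| = \sum_(a : {ffun J -> 'I_d}) 1)%N.
  by rewrite sum1_card card_ffun card_ord.
have -> : (d.-1 ^ #|J| * #|T| = \sum_(a : {ffun J -> 'I_d}) \sum_t miss a t)%N.
  rewrite exchange_big /= mulnC -sum_nat_const; apply: eq_bigr => t _.
  by rewrite -(card_ffun_avoid (c t)) -sum1dep_card big_mkcond.
apply: leq_sum => a _; have /forallPn[t] := negbT (all_miss a).
by rewrite negbK (bigD1 t) //= => ->.
Qed.

(** The inequality is the counting condition of [exists_ffun_hitting] for the d ^ #|I| characters of
    (Z/d)^I, each encoded by a function [t]. *)
Lemma zero_sum_mod (d : nat) (I J : finType) (v : J -> I -> nat) : (0 < d)%N ->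
  (d.-1 ^ #|J| * d ^ #|I| < d ^ #|J|)%N ->
  exists2 S : {set J}, S != set0 & forall i, (d %| \sum_(j in S) v j i)%N.
Proof.
move=> d_gt0 lt_card; have [w wP] := C_prim_root_exists d_gt0.
(* The character indexed by [t] takes the value w ^ [c t j] at the vector [v j]. *)
pose c (t : {ffun I -> 'I_d}) j : 'I_d :=
  Ordinal (ltn_pmod (\sum_i t i * v j i)%N d_gt0).
have [|a aP] := @exists_ffun_hitting d J _ c.
  by rewrite card_ffun card_ord.
have zero t : \prod_j (- w ^+ c t j + w ^+ a j) = 0.
  by have [j aj] := aP t; rewrite (bigD1 j) //= aj addNr mul0r.
have [S SP|noS] := pickP [pred S : {set J} |
    (S != set0) && [forall i, d %| \sum_(j in S) v j i]%N].
  by have /andP[S0 /forallP] := SP; exists S.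
pose coef (S : {set J}) : algC := \prod_(j in S) -1 * \prod_(j in ~: S) w ^+ a j.
have expand (t : {ffun I -> 'I_d}) : 0 = \sum_(S : {set J})
    coef S * \prod_i w ^+ (t i * \sum_(j in S) v j i).
  rewrite -[LHS](zero t) bigA_distr; apply: eq_big => // S _.
  rewrite (bigID [in S]) /= /coef mulrAC; congr (_ * _); last first.
    by apply: eq_big => j; rewrite ?inE // => /negbTE->.
  under [X in _ = _ * X]eq_bigr do rewrite big_distrr.
  rewrite prodrXr exchange_big -prodrXr -big_split /=; apply: eq_bigr => j jS.
  by rewrite jS (prim_expr_mod wP) mulN1r.
have /eqP : \sum_(t : {ffun I -> 'I_d}) (0 : algC) = 0 by rewrite big1.
(* After the exchange, [set0] contributes d ^ #|I| times a product of powers of w, which is nonzero.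
   Any other S has a coordinate whose sum is not divisible by d, and the sum over that coordinate of
   [t] vanishes. *)
rewrite (eq_bigr _ (fun t _ => expand t)) exchange_big /= (bigD1 set0) //=.
rewrite [X in _ + X]big1 => [|S S0].
  rewrite addr0 (eq_bigr (fun=> coef set0)); last first.
    by move=> t _; rewrite big1 ?mulr1 // => i _; rewrite big_set0 muln0.
  rewrite sumr_const -mulr_natr card_ffun card_ord /coef big_set0 mul1r.
  rewrite mulf_eq0 pnatr_eq0 expn_eq0 (gtn_eqF d_gt0) /= orbF.
  rewrite prodf_seq_eq0 => /hasP[j _ /andP[_]].
  by rewrite expf_eq0 (prim_root_eq0 wP) (gtn_eqF d_gt0) andbF.
rewrite -big_distrr /= -(bigA_distr_bigA
  (fun i (k : 'I_d) => w ^+ (k * \sum_(j in S) v j i))) /=.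
have := noS S; rewrite /= S0 /= => /negbT/forallPn[i ndiv].
by rewrite (bigD1 i) //= sum_powers_root_unity // (negbTE ndiv) mul0r mulr0.
Qed.

(** * Valuations and perfect powers *)

Lemma logn_prodn (I : finType) (P : pred I) (F : I -> nat) (p : nat) :
  (forall i, P i -> 0 < F i)%N ->
  logn p (\prod_(i | P i) F i)%N = (\sum_(i | P i) logn p (F i))%N.
Proof.
move=> F_gt0; suff [//] : (0 < \prod_(i | P i) F i)%N /\
  logn p (\prod_(i | P i) F i)%N = (\sum_(i | P i) logn p (F i))%N.
elim/big_rec2: _ => [|i _ m Pi [m_gt0 <-]]; first by rewrite logn1.
by rewrite muln_gt0 m_gt0 F_gt0 // lognM ?F_gt0.
Qed.

Lemma dvdn_logn_expn (d n : nat) : (0 < n)%N ->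
  (forall p, prime p -> d %| logn p n)%N -> exists x, n = (x ^ d)%N.
Proof.
move=> n_gt0 d_dvd; exists (\prod_(p <- primes n) p ^ (logn p n %/ d))%N.
rewrite {1}(prod_prime_decomp n_gt0) prime_decompE big_map /=.
rewrite (big_morph (fun m => m ^ d)%N (fun m1 m2 => expnMn m1 m2 d) (exp1n d)).
apply: eq_big_seq => p; rewrite mem_primes => /andP[p_pr _].
by rewrite -expnM divnK ?d_dvd.
Qed.

Lemma logn_lt_sqr (p n : nat) : prime p -> (0 < n < p * p)%N ->
  logn p n = (p %| n)%N.
Proof.
move=> p_pr /andP[n_gt0 n_lt].
have lt2 : (logn p n < 2)%N.
  rewrite ltnNge -pfactor_dvdn // -mulnn; apply/negP => /(dvdn_leq n_gt0).
  by rewrite leqNgt n_lt.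
have := pfactor_dvdn 1 p_pr n_gt0; rewrite expn1 => ->.
by case: (logn p n) lt2 => [|[]].
Qed.

(** If p and q were distinct, p * q would divide n and be at most N, yet both exceed sqrt N. *)
Lemma dvdn_large_primes (N p q n : nat) : prime p -> prime q ->
  (N < p * p)%N -> (N < q * q)%N -> (0 < n <= N)%N ->
  (p %| n)%N -> (q %| n)%N -> p = q.
Proof.
move=> p_pr q_pr pN qN /andP[n_gt0 nN] pn qn; apply/eqP/negPn/negP => pq.
have : (p * q %| n)%N by rewrite Gauss_dvd ?pn ?qn // prime_coprime // dvdn_prime2.
by move=> /(dvdn_leq n_gt0); nia.
Qed.

(** * Lower bound *)

Definition smooth_primes (N : nat) : {set 'I_N.+1} :=
  [set q : 'I_N.+1 | prime q && (q * q <= N)%N].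

(** For k > 0 its cardinal is pi (N / k), with the division cleared to stay in [nat]. *)
Definition primes_scaled_le (N k : nat) : {set 'I_N.+1} :=
  [set q : 'I_N.+1 | prime q && (k * q <= N)%N].

(** The error term pays for discarding, for each of the d - 1 values of k, the primes up to sqrt
    N. *)
Lemma rho_lower (d N : nat) : (1 < d)%N ->
  (\sum_(1 <= k < d) #|primes_scaled_le N k| <=
     rho d N + d.-1 * #|smooth_primes N|)%N.
Proof.
move=> d_gt1.
(* A pair (p, k) stands for p * k. It can be recovered from the product, as p is the only prime
   factor above sqrt N. *)
pose X := [set u : 'I_N.+1 * 'I_d |
  [&& prime u.1, (N < u.1 * u.1)%N, (0 < u.2)%N & (u.1 * u.2 <= N)%N]].
pose f (u : 'I_N.+1 * 'I_d) : 'I_N.+1 := inord (u.1 * u.2).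
have fE u : u \in X -> f u = (u.1 * u.2)%N :> nat.
  by rewrite inE => /and4P[_ _ _ le]; rewrite /f inordK.
have f_bnd u : u \in X -> (0 < f u <= N)%N.
  move=> uX; rewrite fE //; move: uX; rewrite inE => /and4P[/prime_gt0 ? _ ? ->].
  by rewrite muln_gt0 andbT; apply/andP.
have dvd_f u p : u \in X -> prime p -> (N < p * p)%N -> (p %| f u)%N -> u.1 = p :> nat.
  move=> uX p_pr pN pu; have bnd := f_bnd u uX.
  have := uX; rewrite inE => /and4P[u1_pr u1N _ _].
  by apply: dvdn_large_primes bnd _ pu => //; rewrite fE // dvdn_mulr.
have f_inj : {in X &, injective f}.
  move=> u v uX vX fuv.
  have := vX; rewrite inE => /and4P[v1_pr v1N _ _].
  have uv1 : u.1 = v.1 :> nat.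
    by apply: dvd_f => //; rewrite fuv fE // dvdn_mulr.
  have : f u = f v :> nat by rewrite fuv.
  rewrite !fE // uv1 => /eqP; rewrite eqn_pmul2l ?prime_gt0 // => /eqP uv2.
  by case: u v uv1 uv2 {fuv v1_pr v1N uX vX} => u1 u2 [v1 v2] /= /val_inj-> /val_inj->.
have cardX : (#|f @: X| <= rho d N)%N.
  apply: (leq_bigmax_cond (F := fun A : {set 'I_N.+1} => #|A|)).
  apply/andP; split.
    apply/subsetP => _ /imsetP[u uX ->]; rewrite inE.
    by have /andP[] := f_bnd u uX.
  apply/asboolP => B sBX /set0Pn[b bB] [x xE].
  have B_gt0 a : a \in B -> (0 < a <= N)%N.
    by move=> /(subsetP sBX)/imsetP[u uX ->]; exact: f_bnd.
  have /imsetP[u uX bE] := subsetP sBX b bB.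
  have := uX; rewrite inE => /and4P[p_pr pN _ _]; set p : nat := u.1 in p_pr pN.
  pose Bp := [set a in B | p %| a]%N.
  have lognB : logn p (\prod_(a in B) a)%N = #|Bp|.
    rewrite logn_prodn => [|a /B_gt0/andP[]//].
    rewrite -sum1dep_card big_mkcondr; apply: eq_bigr => a /B_gt0/andP[a0 aN].
    rewrite logn_lt_sqr ?a0 ?(leq_ltn_trans aN) //.
  have Bp_gt0 : (0 < #|Bp|)%N.
    by apply/card_gt0P; exists b; rewrite inE bB bE fE // dvdn_mulr.
  have Bp_lt : (#|Bp| < d)%N.
    have sub : Bp \subset [set f (u.1, k) | k in [set~ Ordinal (ltnW d_gt1)]].
      apply/subsetP => a; rewrite inE => /andP[aB pa].
      have /imsetP[v vX aE] := subsetP sBX a aB.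
      have v1 : v.1 = u.1 by apply/val_inj/dvd_f; rewrite -?aE.
      apply/imsetP; exists v.2; last by rewrite aE -v1; case: (v).
      move: vX; rewrite !inE => /and4P[_ _ v2_gt0 _].
      by apply/eqP => v20; rewrite v20 in v2_gt0.
    rewrite (leq_ltn_trans (subset_leq_card sub)) //.
    rewrite (leq_ltn_trans (leq_imset_card _ _)) // cardsC1 card_ord.
    by rewrite prednK // ltnW.
  (* The root x may be negative, so the valuation is taken on absolute values. *)
  have : (d %| #|Bp|)%N.
    rewrite -lognB -[(\prod_(a in B) a)%N]/`|(\prod_(a in B) a)%N%:Z|%N xE abszX.
    by rewrite lognX dvdn_mulr.
  by move/(dvdn_leq Bp_gt0); rewrite leqNgt Bp_lt.
apply: leq_trans (leq_add cardX (leqnn _)); rewrite card_in_imset //.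
have -> : (d.-1 * #|smooth_primes N| = \sum_(1 <= k < d) #|smooth_primes N|)%N.
  by rewrite sum_nat_const_nat subn1.
have -> : #|X| = (\sum_(1 <= k < d)
    #|[set q : 'I_N.+1 | [&& prime q, (N < q * q) & (q * k <= N)]]|)%N.
  rewrite -sum1_card.
  transitivity (\sum_(k < d) \sum_(q < N.+1) (
    [&& prime q, (N < q * q), (0 < k) & (q * k <= N)] : nat))%N.
    rewrite exchange_big pair_big /= big_mkcond /=.
    by apply: eq_bigr => u _; rewrite inE; case: ifP.
  rewrite -(big_mkord xpredT (fun k => \sum_(q < N.+1) (
    [&& prime q, (N < q * q), (0 < k) & (q * k <= N)] : nat))%N).
  rewrite big_ltn ?(ltnW d_gt1) // big1 ?add0n => [|q _]; last first.
    by rewrite ltnn !andbF.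
  apply: eq_big_nat => k /andP[k_gt0 _].
  by rewrite -sum1dep_card [RHS]big_mkcond k_gt0; apply: eq_bigr => q _ /=; case: ifP.
rewrite -big_split /=; apply: leq_sum => k _.
apply: leq_trans (leq_card_setU _ _); apply/subset_leq_card/subsetP => q.
by rewrite !inE mulnC => /andP[-> ->]; rewrite /= andbT ltnNge orNb.
Qed.

(** * Upper bound *)

Lemma zero_sum_card (d n r : nat) : (1 < d)%N -> (d * d * r < n)%N ->
  (d.-1 ^ n * d ^ r < d ^ n)%N.
Proof.
move=> d_gt1 lt_n; have := mul_exp_pred_lt d_gt1; set K := (d * d)%N in lt_n * => ltK.
(* Each of r groups of d * d factors d.-1 absorbs one factor d by [ltK]; the n - d * d * r > 0
   remaining factors make the inequality strict. *)
rewrite -(subnKC (ltnW lt_n)) !expnD !(expnM _ K) mulnAC -expnMn.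
have lt_e : (0 < n - K * r)%N by rewrite subn_gt0.
apply: (@leq_ltn_trans ((d ^ K) ^ r * d.-1 ^ (n - K * r))).
  rewrite leq_mul // mulnC; case: r {lt_n lt_e} => [|r]; first by rewrite !expn0.
  by rewrite leq_exp2r // ltnW.
by rewrite ltn_pmul2l ?expn_gt0 ?(ltnW d_gt1) // ltn_exp2r // prednK // ltnW.
Qed.

Definition power_at_large_primes (d N : nat) (B : {set 'I_N.+1}) : Prop :=
  forall q, prime q -> (N < q * q)%N -> (d %| logn q (\prod_(a in B) a)%N)%N.

(** With more blocks, the zero-sum bound applied to the valuations of their products at the primes
    up to sqrt N selects blocks whose union has a d-th power as product. *)
Lemma card_disjoint_blocks (d N : nat) (A : {set 'I_N.+1})
    (P : {set {set 'I_N.+1}}) : (1 < d)%N ->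
  (forall a, a \in A -> 0 < a)%N -> power_product_free d A -> trivIset P ->
  (forall B, B \in P ->
     [/\ B != set0, B \subset A & power_at_large_primes d B]) ->
  (#|P| <= d * d * #|smooth_primes N|)%N.
Proof.
move=> d_gt1 A_gt0 freeA trivP PP; rewrite leqNgt; apply/negP => ltP.
pose I := {q : 'I_N.+1 | q \in smooth_primes N}; pose J := {B | B \in P}.
have [||S S0 Sdvd] := @zero_sum_mod d I J
    (fun B q => logn (val q) (\prod_(a in val B) a)%N); first exact: ltnW.
  by rewrite !card_sig; exact: zero_sum_card.
pose Q := [set val B | B in S].
have sQP : Q \subset P by apply/subsetP => _ /imsetP[B _ ->]; exact: (valP B).
have trivQ : trivIset Q := trivIsetS sQP trivP.
have sQA : cover Q \subset A.
  by apply/bigcupsP => B /(subsetP sQP)/PP[].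
have Q_gt0 a : a \in cover Q -> (0 < a)%N by move=> /(subsetP sQA)/A_gt0.
apply: (freeA (cover Q)) => //.
  have /set0Pn[B BS] := S0; have [/set0Pn[a aB] _ _] := PP _ (valP B).
  by apply/set0Pn; exists a; apply/bigcupP; exists (val B) => //; exact: imset_f.
have [|q q_pr|x xE] := @dvdn_logn_expn d (\prod_(a in cover Q) a)%N.
- by apply: prodn_cond_gt0.
- have PBgt0 B : B \in P -> (0 < \prod_(a in B) a)%N.
    by move=> /PP[_ /subsetP sBA _]; apply: prodn_cond_gt0 => a /sBA/A_gt0.
  rewrite big_trivIset //= logn_prodn => [|B /(subsetP sQP)/PBgt0//].
  rewrite big_imset /=; last by move=> ? ? _ _ /val_inj.
  have [qN|qN] := leqP (q * q) N.
    have qNS : (q < N.+1)%N by rewrite ltnS (leq_trans _ qN) // leq_pmulr ?prime_gt0.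
    have qs : Ordinal qNS \in smooth_primes N by rewrite inE q_pr.
    exact: (Sdvd (exist _ (Ordinal qNS) qs)).
  apply: dvdn_sum => B _; have [_ _] := PP _ (valP B); exact.
- by exists x%:Z; rewrite xE -!natz natrX.
Qed.

(** The minimum of d - 1 and N / q is written as a sum over k, ready to be exchanged with a sum over
    q. *)
Lemma leq_card_multiples (d N q m : nat) : (0 < q)%N ->
  (m <= d.-1)%N -> (m <= N %/ q)%N -> (m <= \sum_(1 <= k < d) (k * q <= N))%N.
Proof.
move=> q_gt0 md mN; case: d md => [|d] /= md; first by rewrite leqn0 in md; rewrite (eqP md).
rewrite (@big_cat_nat _ _ _ m.+1) //= (leq_trans _ (leq_addr _ _)) //.
rewrite (eq_big_nat _ _ (F2 := fun=> 1%N)) ?sum_nat_const_nat ?subn1 ?muln1 //.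
by move=> k /andP[_ km]; rewrite -leq_divRL // (leq_trans _ mN).
Qed.

Lemma card_block_free (d N : nat) (R : {set 'I_N.+1}) : (1 < d)%N ->
  (forall a, a \in R -> 0 < a)%N ->
  (forall B : {set 'I_N.+1}, B \subset R -> B != set0 -> (#|B| <= d)%N ->
     ~ power_at_large_primes d B) ->
  (#|R| <= \sum_(1 <= k < d) #|primes_scaled_le N k|)%N.
Proof.
move=> d_gt1 R_gt0 noblock.
have bnd a : a \in R -> (0 < a <= N)%N.
  by move=> /R_gt0 ->; rewrite -ltnS ltn_ord.
have large_factor a : a \in R ->
    exists q : 'I_N.+1, [&& prime q, (N < q * q)%N & (q %| a)%N].
  move=> aR; apply/existsP; apply: contraT => /existsPn noq; exfalso.
  (* Without a prime factor above sqrt N, a alone is a block: its large valuations are all 0. *)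
  apply: (noblock [set a]); rewrite ?sub1set ?cards1 ?(ltnW d_gt1) //.
    by apply/set0Pn; exists a; rewrite inE.
  move=> q q_pr qN; rewrite big_set1; have [a_gt0 aN] := andP (bnd a aR).
  rewrite logn_lt_sqr ?a_gt0 ?(leq_ltn_trans aN) //.
  have [qa|] := boolP (q %| a)%N; last by rewrite dvdn0.
  have qNS : (q < N.+1)%N by rewrite ltnS (leq_trans (dvdn_leq a_gt0 qa)).
  by have := noq (Ordinal qNS); rewrite /= q_pr qN qa.
have few_multiples (q : 'I_N.+1) : prime q -> (N < q * q)%N ->
    (#|[set a in R | (q %| a)%N]| <= \sum_(1 <= k < d) (k * q <= N))%N.
  move=> q_pr qN; have q_gt0 := prime_gt0 q_pr; apply: leq_card_multiples => //.
    rewrite -ltnS prednK ?(ltnW d_gt1) // ltnNge; apply/negP => /card_geqP.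
    case=> s [s_uniq size_s sR].
    (* Any d multiples of q form a block: the valuation of their product is d at q and 0 at every
       other large prime. *)
    pose B := [set a in s].
    have BR a : a \in B -> a \in R /\ (q %| a)%N.
      by rewrite inE => /sR; rewrite inE => /andP[].
    have cardB : #|B| = d by rewrite cardsE (card_uniqP s_uniq).
    apply: (noblock B); rewrite ?cardB //.
    - by apply/subsetP => a /BR[].
    - by rewrite -card_gt0 cardB ltnW.
    - move=> p p_pr pN; rewrite logn_prodn => [|a /BR[/R_gt0]//].
      rewrite (eq_bigr (fun=> (p == q) : nat)) => [|a /BR[/bnd a_bnd qa]].
        by rewrite sum_nat_const cardB dvdn_mulr.
      have [a_gt0 aN] := andP a_bnd.
      rewrite logn_lt_sqr ?a_gt0 ?(leq_ltn_trans aN) //; congr nat_of_bool.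
      apply/idP/eqP => [pa|-> //]; exact: (dvdn_large_primes p_pr q_pr pN qN a_bnd).
  have sub : [set a in R | (q %| a)%N] \subset
      [set inord (k.+1 * q) | k : 'I_(N %/ q)].
    apply/subsetP => a; rewrite inE => /andP[/bnd/andP[a_gt0 aN] qa].
    have aq_gt0 : (0 < a %/ q)%N by rewrite divn_gt0 // dvdn_leq.
    have lt_aq : ((a %/ q).-1 < N %/ q)%N by rewrite prednK // leq_div2r.
    apply/imsetP; exists (Ordinal lt_aq) => //.
    by apply: val_inj; rewrite /= prednK // divnK // inordK.
  apply: leq_trans (subset_leq_card sub) _.
  by apply: leq_trans (leq_imset_card _ _) _; rewrite card_ord.
pose L (q : 'I_N.+1) := prime q && (N < q * q)%N.
(* Double counting of the pairs (a, q) with q a large prime factor of a. *)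
apply: (@leq_trans (\sum_(q | L q) #|[set a in R | (q %| a)%N]|)).
  rewrite -sum1_card; under [leqRHS]eq_bigr do
    rewrite -sum1dep_card big_mkcondr /=.
  rewrite exchange_big /=; apply: leq_sum => a /large_factor[q /and3P[q_pr qN qa]].
  by rewrite (bigD1 q) ?qa // /L q_pr.
apply: (@leq_trans (\sum_(q | L q) \sum_(1 <= k < d) (k * q <= N))).
  by apply: leq_sum => q /andP[q_pr qN]; exact: few_multiples.
rewrite exchange_big /=; apply: leq_sum => k _.
rewrite -sum1dep_card big_mkcondr /= big_mkcond [leqRHS]big_mkcond /=.
by apply: leq_sum => q _; rewrite /L; case: (prime q) => //=; case: ltnP => // _; case: leqP.
Qed.

Lemma rho_upper (d N : nat) : (1 < d)%N ->
  (rho d N <= \sum_(1 <= k < d) #|primes_scaled_le N k| +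
     d * (d * d * #|smooth_primes N|))%N.
Proof.
move=> d_gt1; apply/bigmax_leqP => A /andP[/subsetP A_pos /asboolP freeA].
have A_gt0 a : a \in A -> (0 < a)%N by move=> /A_pos; rewrite inE.
pose block (B : {set 'I_N.+1}) :=
  [&& B != set0, B \subset A, (#|B| <= d)%N & `[< power_at_large_primes d B >]].
pose packing (P : {set {set 'I_N.+1}}) := trivIset P && [forall B in P, block B].
have [|P /maxsetP[/andP[trivP /forall_inP blockP] maxP] _] :=
    @maxset_exists _ packing set0.
  apply/andP; split; last by apply/forall_inP => B; rewrite inE.
  by apply/trivIsetP => B C; rewrite inE.
have cardP : (#|P| <= d * d * #|smooth_primes N|)%N.
  apply: (card_disjoint_blocks d_gt1 A_gt0 freeA trivP).
  by move=> B /blockP/and4P[? ? _ /asboolP].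
have card_cover : (#|cover P| <= d * #|P|)%N.
  rewrite (leq_trans (leq_card_cover P)) // mulnC -sum_nat_const.
  by apply: leq_sum => B /blockP/and4P[].
have card_rest : (#|A :\: cover P| <= \sum_(1 <= k < d) #|primes_scaled_le N k|)%N.
  apply: card_block_free => // [a|B].
    by rewrite inE => /andP[_ /A_gt0].
  (* A block B outside the cover could be added to [P]; maximality puts it in [P] already, which
     disjointness and B nonempty forbid. *)
  rewrite subsetD => /andP[sBA disjB] B0 leBd pB.
  have [||trivBP] := @trivIsetU1 _ B P _ trivP.
  - move=> C CP; apply: disjointWr disjB; exact: bigcup_sup.
  - by apply/negP => /blockP; rewrite /block eqxx.
  - move=> /negP; apply; rewrite -(maxP (B |: P)) ?setU11 ?subsetUr //.
    apply/andP; split=> //; apply/forall_inP => C; rewrite !inE.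
    by case/predU1P => [->|/blockP//]; apply/and4P; split=> //; apply/asboolP.
rewrite -(cardsID (cover P) A) addnC leq_add // (leq_trans _ (leq_mul (leqnn d) cardP)) //.
by rewrite (leq_trans _ card_cover) // subset_leq_card // subsetIr.
Qed.

(** * Passage to the prime-counting function on reals *)

Lemma primepiE (R : realType) (N : nat) (x : R) : 0 <= x <= N%:R ->
  primepi x = #|[set q : 'I_N.+1 | prime q && (q%:R <= x)]|.
Proof.
move=> /andP[x_ge0 xN]; rewrite /primepi -sum1_count -sum1dep_card.
have le_xN : ((Num.truncn x).+1 <= N.+1)%N.
  by rewrite ltnS -(ler_nat R) (le_trans _ xN) // truncn_le.
rewrite -[iota _ _]/(index_iota 0 (Num.truncn x).+1) (big_nat_widen _ _ _ _ _ le_xN).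
rewrite big_mkord; apply: eq_bigl => q.
by rewrite ltnS truncn_ge_nat.
Qed.

Theorem theorem3 (R : realType) (d : nat) (hd : (2 <= d)%N) :
  exists C : R, forall N : nat, (1 <= N)%N ->
    `| (rho d N)%:R - \sum_(1 <= k < d) (primepi (N%:R / k%:R : R))%:R |
      <= C * (primepi (Num.sqrt (N%:R : R)))%:R.
Proof.
(* At most d * d disjoint blocks per prime up to sqrt N, of at most d elements each; the lower bound
   loses only d - 1 per prime. *)
exists (d ^ 3)%:R => N N_gt0.
have natr_sqrt_sqr n : n%:R = Num.sqrt (n * n)%:R :> R.
  by rewrite natrM -expr2 sqrtr_sqr normr_nat.
have -> : primepi (Num.sqrt (N%:R : R)) = #|smooth_primes N|.
  rewrite (@primepiE _ N); last first.
    by rewrite sqrtr_ge0 [leRHS]natr_sqrt_sqr ler_sqrt ?ler0n // ler_nat leq_pmulr.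
  by apply: eq_card => q; rewrite !inE (natr_sqrt_sqr q) ler_sqrt ?ler0n // ler_nat.
have -> : \sum_(1 <= k < d) (primepi (N%:R / k%:R : R))%:R =
    (\sum_(1 <= k < d) #|primes_scaled_le N k|)%:R :> R.
  rewrite natr_sum; apply: eq_big_nat => k /andP[k_gt0 _]; congr _%:R.
  have k_gt0' : 0 < k%:R :> R by rewrite ltr0n.
  rewrite (@primepiE _ N); last first.
    by rewrite divr_ge0 //= ler_pdivrMr // -natrM ler_nat leq_pmulr.
  by apply: eq_card => q; rewrite !inE ler_pdivlMr // -natrM ler_nat mulnC.
have lower := rho_lower N hd; have upper := rho_upper N hd.
rewrite -natrM ler_norml; apply/andP; split.
  rewrite lerBrDr addrC lerBlDr -natrD ler_nat.
  apply: leq_trans lower _; rewrite leq_add2l leq_mul2r; apply/orP; right.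
  by rewrite (leq_trans (leq_pred d)) // -{1}(expn1 d) leq_exp2l.
rewrite lerBlDr -natrD ler_nat addnC (leq_trans upper) // leq_add2l.
by rewrite !mulnA !expnS expn0 muln1 mulnA.
Qed.
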